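(* Let $(X,R)$ be a commutative word rewriting system. Then $\mathcal{N}(\Sigma^3(X,R))=(X,R)$ and the graphs $G(\Sigma^3(X,R))$ and $G(X,R)$ are isomorphic; furthermore, this isomorphism identifies the congruences $\equiv_{(X,R)}$ and $\equiv_{\Sigma^3(X,R)}$. Conversely, given any $3$-polygraph $\Sigma=(\ast,\emptyset,\Sigma_2,\Sigma_3)$ (one $0$-cell and no $1$-cell), the equality $\Sigma^3(\mathcal{N}(\Sigma))=\Sigma$ holds and the graphs $G(\Sigma)$ and $G(\mathcal{N}(\Sigma))$ are isomorphic; furthermore, this isomorphism identifies the congruences $\equiv_\Sigma$ and $\equiv_{\mathcal{N}(\Sigma)}$.
   Context: Graphs are directed and may have parallel arrows. A congruence on the paths of a graph is an equivalence relation between parallel paths compatible with concatenation. An isomorphism of graphs identifies two congruences when the induced bijection on paths carries one onto the other. Commutative word rewriting systems. $[X]$ is the free commutative monoid on the set $X$, written additively. A commutative word rewriting system is a pair $(X,R)$ with $X$ a set and $R$ a family of pairs $\alpha=(s(\alpha),t(\alpha))$ of elements of $[X]$ (not necessarily finite). Its reduction graph $G(X,R)$ has the elements of $[X]$ as objects, and as arrows the pairs $(c,\alpha)$, written $c+\alpha$, with $c\in[X]$, $\alpha\in R$, with source $c+s(\alpha)$ and target $c+t(\alpha)$. The relation $\equiv_{(X,R)}$ is the congruence on paths of $G(X,R)$ generated by identifying, for all $\alpha,\beta\in R$, $c\in[X]$, the path ''$(c+s(\beta))+\alpha$ followed by $(c+t(\alpha))+\beta$'' with the path ''$(c+s(\alpha))+\beta$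 followed by $(c+t(\beta))+\alpha$''. $3$-polygraphs with one $0$-cell and no $1$-cell. A $2$-polygraph $(\ast,\emptyset,\Sigma_2)$ with one $0$-cell and no $1$-cell is given by a set $\Sigma_2$ of $2$-cells, each with source and target the unique $1$-arrow $0=\mathrm{id}_\ast$ (the empty path). In the free $2$-category it generates, all $2$-arrows go from $0$ to $0$; on the set $\langle\Sigma\rangle_2$ of $2$-arrows the two compositions (horizontal $\otimes$ and vertical $\circ$) coincide and are commutative; they are denoted $+$, with neutral element $0$, and $(\langle\Sigma\rangle_2,+,0)$ is identified with the free commutative monoid $[\Sigma_2]$. A $3$-polygraph $\Sigma=(\ast,\emptyset,\Sigma_2,\Sigma_3)$ is given by such a $2$-polygraph together with a set $\Sigma_3$ of $3$-cells and two maps $s_2,t_2:\Sigma_3\to\langle\Sigma\rangle_2$. Its reduction graph $G(\Sigma)$ has the elements of $\langle\Sigma\rangle_2$ as objects; its arrows from $u$ to $v$ are the triples $(f,\alpha,g)$ with $f,g\in\langle\Sigma\rangle_2$, $\alpha\in\Sigma_3$, $u=g\circ s_2(\alpha)\circ f=f+s_2(\alpha)+g$ and $v=g\circ t_2(\alpha)\circ f=f+t_2(\alpha)+g$, considered modulo the deformation equations $(f+h,\alpha,g)=(f,\alpha,h+g)$ for all $f,g,h\in\langle\Sigma\rangle_2$. For an arrow $A=(f,\alpha,g)$ of $G(\Sigma)$, write $s_2(A)$, $t_2(A)$ for its source and target, and for $c\in\langle\Sigma\rangle_2$ let $c+A=A+c=(c+f,\alpha,g)$. With $\star$ denoting composition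 of paths ($A\star B$ is $A$ followed by $B$), $\equiv_\Sigma$ is the congruence on paths of $G(\Sigma)$ generated by the exchange relations $$(A+s_2(B))\star(t_2(A)+B)\ \equiv_\Sigma\ (s_2(A)+B)\star(A+t_2(B))$$ for arrows $A,B$ of $G(\Sigma)$. Translations. $\Sigma^3(X,R)$ is the $3$-polygraph $(\ast,\emptyset,X,R)$, where each rule $\alpha=(a,b)\in R$ is seen as a $3$-cell with $2$-source $s_2(\alpha)=a$ and $2$-target $t_2(\alpha)=b$ (elements of $[X]=\langle(\ast,\emptyset,X)\rangle_2$). Conversely, for $\Sigma=(\ast,\emptyset,\Sigma_2,\Sigma_3)$, $\mathcal{N}(\Sigma)=(\Sigma_2,\Sigma_3)$ is the commutative word rewriting system with alphabet $\Sigma_2$ and rules the $3$-cells $\alpha$, seen as pairs $(s_2(\alpha),t_2(\alpha))$. *)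

(* Defs.v *)
From HB Require Import structures.
From Stdlib Require Import Relations.
From mathcomp Require Import all_boot all_algebra.
From mathcomp Require Import finmap multiset.
From mathcomp Require Import boolp.

Set Implicit Arguments.
Unset Strict Implicit.
Unset Printing Implicit Defensive.

Import GRing.Theory.
Local Open Scope quotient_scope.
Local Open Scope ring_scope.

Record graph := Graph {
  vertex : Type;
  arrow : Type;
  src : arrow -> vertex;
  tgt : arrow -> vertex }.

Section Paths.
Variable G : graph.
Implicit Types (x y z : vertex G) (s : seq (arrow G)).

Fixpoint is_path x s y : Prop :=
  if s is a :: s' then src a = x /\ is_path (tgt a) s' y else x = y.

(* Paths are lists of arrows rather than an inductive family, so that paths
   whose endpoints are equal only propositionally (such as c + s(b) + t(a) and
   c + t(a) + s(b)) compose without transport. *)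
Definition gpath x y := {s : seq (arrow G) | is_path x s y}.

Definition arrows_of x y (p : gpath x y) : seq (arrow G) := sval p.

Lemma is_path_cat x y z s1 s2 :
  is_path x s1 y -> is_path y s2 z -> is_path x (s1 ++ s2) z.
Proof. by elim: s1 x => [|a s1 IH] x /= => [->|[-> /IH h /h]]. Qed.

Definition pcat x y z (p : gpath x y) (q : gpath y z) : gpath x z :=
  exist _ (sval p ++ sval q) (is_path_cat (svalP p) (svalP q)).

Definition path_rel := forall x y, relation (gpath x y).

Record is_congruence (E : path_rel) : Prop := IsCongruence {
  cong_equiv : forall x y, equivalence _ (@E x y);
  cong_cat : forall x y z (p p' : gpath x y) (q q' : gpath y z),
    E _ _ p p' -> E _ _ q q' -> E _ _ (pcat p q) (pcat p' q') }.

Definition generated_cong (S : path_rel) : path_rel := fun x y p q =>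
  forall E : path_rel, is_congruence E ->
    (forall x' y' (p' q' : gpath x' y'), S _ _ p' q' -> E _ _ p' q') ->
    E x y p q.

Lemma generated_congP S : is_congruence (generated_cong S).
Proof.
split=> [x y|x y z p p' q q' h1 h2 E cE sE].
  split=> [p|p q r h1 h2|p q h] E cE sE.
  - exact: (Relation_Definitions.equiv_refl _ _ (cong_equiv cE x y)).
  - exact: (Relation_Definitions.equiv_trans _ _ (cong_equiv cE x y) _ _ _ (h1 E cE sE) (h2 E cE sE)).
  - exact: (Relation_Definitions.equiv_sym _ _ (cong_equiv cE x y) _ _ (h E cE sE)).
by apply: (cong_cat cE); [apply: h1|apply: h2].
Qed.

End Paths.

Record graph_iso (G H : graph) := GraphIso {
  iso_vertex : vertex G -> vertex H;
  iso_arrow : arrow G -> arrow H;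
  iso_src : forall a, src (iso_arrow a) = iso_vertex (src a);
  iso_tgt : forall a, tgt (iso_arrow a) = iso_vertex (tgt a);
  iso_vertex_bij : bijective iso_vertex;
  iso_arrow_bij : bijective iso_arrow }.

Section IsoPaths.
Variables (G H : graph) (phi : graph_iso G H).

Lemma is_path_map x s y :
  is_path x s y -> is_path (iso_vertex phi x) (map (iso_arrow phi) s) (iso_vertex phi y).
Proof.
elim: s x => [|a s IH] x /= => [->//|[<- /IH h]].
by rewrite iso_src iso_tgt.
Qed.

Definition iso_path x y (p : gpath x y) :
    gpath (iso_vertex phi x) (iso_vertex phi y) :=
  exist _ (map (iso_arrow phi) (sval p)) (is_path_map (svalP p)).

Lemma iso_path_bij x y : bijective (@iso_path x y).
Proof.
have vI := bij_inj (iso_vertex_bij phi).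
have [g fK gK] := iso_arrow_bij phi.
have inv_ok s z w : is_path (iso_vertex phi z) s (iso_vertex phi w) ->
    is_path z (map g s) w.
  elim: s z => [|b s IH] z /=; first exact: vI.
  rewrite -{1 2}(gK b) iso_src iso_tgt => -[/vI e /IH hs].
  by split.
exists (fun q => exist _ (map g (sval q)) (inv_ok _ _ _ (svalP q))) => -[s hs].
  by apply: eq_exist => /=; rewrite mapK.
by apply: eq_exist => /=; rewrite mapK.
Qed.

(* As phi induces bijections on vertices and on paths, the equivalence says
   exactly that the image of E is F. *)
Definition identifies (E : path_rel G) (F : path_rel H) : Prop :=
  forall x y (p q : gpath x y), E _ _ p q <-> F _ _ (iso_path p) (iso_path q).

End IsoPaths.

(* Finite multisets; {classic X} endows the arbitrary type X with the
   choiceType structure required by {mset _}. *)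
Definition free_cmon (X : Type) : Type := {mset {classic X}}%mset.

HB.instance Definition _ X := Choice.on (free_cmon X).

Section FreeCmon.
Variable X : Type.
Let msetD_free (a b : free_cmon X) : free_cmon X := (a `+` b)%mset.
Let mset0_free : free_cmon X := mset0.
Let addA : associative msetD_free. Proof. by move=> a b c; exact: msetDA. Qed.
Let addC : commutative msetD_free. Proof. by move=> a b; exact: msetDC. Qed.
Let add0 : left_id mset0_free msetD_free. Proof. by move=> a; exact: mset0D. Qed.
HB.instance Definition _ := GRing.isNmodule.Build (free_cmon X) addA addC add0.
End FreeCmon.

Record cwrs := Cwrs {
  letter : Type;
  rule : Type;
  rule_src : rule -> free_cmon letter;
  rule_tgt : rule -> free_cmon letter }.

Section CwrsGraph.
Variable P : cwrs.

Definition cwrs_graph : graph :=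
  @Graph (free_cmon (letter P)) (free_cmon (letter P) * rule P)
    (fun a => a.1 + rule_src a.2) (fun a => a.1 + rule_tgt a.2).

(* A path being determined by its endpoints and its arrows, p and q are
   required to be the two sides of the exchange square of al, be and c; that
   these are parallel paths is cwrs_exchange_path below. *)
Definition cwrs_exchange : path_rel cwrs_graph := fun x y p q =>
  exists (al be : rule P) (c : free_cmon (letter P)),
    arrows_of p = [:: (c + rule_src be, al); (c + rule_tgt al, be)] /\
    arrows_of q = [:: (c + rule_src al, be); (c + rule_tgt be, al)].

Lemma cwrs_exchange_path (al be : rule P) (c : free_cmon (letter P)) :
  let x := c + rule_src al + rule_src be in
  let y := c + rule_tgt al + rule_tgt be in
  @is_path cwrs_graph x [:: (c + rule_src be, al); (c + rule_tgt al, be)] y /\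
  @is_path cwrs_graph x [:: (c + rule_src al, be); (c + rule_tgt be, al)] y.
Proof. by split; do !split; rewrite //= addrAC. Qed.

Definition cwrs_cong : path_rel cwrs_graph := generated_cong cwrs_exchange.

End CwrsGraph.

(* 3-polygraphs with exactly one 0-cell and no 1-cell: the source and target of
   every 2-cell are then the empty path, so a 2-polygraph is just the set cell2,
   and by Eckmann-Hilton both compositions of 2-arrows of the free 2-category are
   a single commutative one; its 2-arrows are identified with free_cmon cell2. *)
Record polygraph3 := Polygraph3 {
  cell2 : Type;
  cell3 : Type;
  src2 : cell3 -> free_cmon cell2;
  tgt2 : cell3 -> free_cmon cell2 }.

Section PolyGraph.
Variable S : polygraph3.

Definition arrow2 := free_cmon (cell2 S).

(* (f, al, g) stands for g o al o f, from g o s(al) o f = f + s(al) + g to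
   g o t(al) o f = f + t(al) + g. *)
Definition whisker : Type := arrow2 * {classic (cell3 S)} * arrow2.
HB.instance Definition _ := Choice.on whisker.

Definition whisker_src (t : whisker) : arrow2 :=
  let: (f, al, g) := t in f + src2 al + g.
Definition whisker_tgt (t : whisker) : arrow2 :=
  let: (f, al, g) := t in f + tgt2 al + g.
Definition whisker_add (c : arrow2) (t : whisker) : whisker :=
  let: (f, al, g) := t in (c + f, al, g).

Inductive deform : relation whisker :=
  Deform f al g h : deform (f + h, al, g) (f, al, h + g).

Definition deformb : rel whisker :=
  fun t u => `[< clos_refl_sym_trans _ deform t u >].

Lemma deformb_refl : reflexive deformb.
Proof. by move=> t; apply/asboolP/rst_refl. Qed.
Lemma deformb_sym : symmetric deformb.
Proof. by move=> t u; apply/asboolP/asboolP; apply: rst_sym. Qed.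
Lemma deformb_trans : transitive deformb.
Proof. by move=> u t v /asboolP h1 /asboolP h2; apply/asboolP/(rst_trans _ _ _ u). Qed.

Canonical deform_equiv := EquivRel deformb deformb_refl deformb_sym deformb_trans.

Definition parrow : Type := {eq_quot deform_equiv}.
Definition class (t : whisker) : parrow := \pi_{eq_quot deform_equiv} t.

Definition parrow_src (A : parrow) : arrow2 := whisker_src (repr A).
Definition parrow_tgt (A : parrow) : arrow2 := whisker_tgt (repr A).
Definition parrow_add (c : arrow2) (A : parrow) : parrow :=
  class (whisker_add c (repr A)).

(* Source, target and c + A do not depend on the representative chosen by repr. *)
Lemma repr_class (T : Type) (k : whisker -> T) :
  (forall t u, deform t u -> k t = k u) -> forall t, k (repr (class t)) = k t.
Proof.
move=> hk t; have /asboolP : deformb (repr (class t)) t.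
  by apply/(eqmodP deform_equiv); rewrite reprK.
by move: (repr _) => u; elim=> [? ? /hk|//|? ? _ ->|? ? ? _ -> _ ->].
Qed.

Lemma class_deform t u : deform t u -> class t = class u.
Proof. by move=> h; apply/(eqmodP deform_equiv)/asboolP/rst_step. Qed.

Lemma parrow_src_class t : parrow_src (class t) = whisker_src t.
Proof.
apply: (repr_class (k := whisker_src)) => {t} _ _ [f al g h] /=.
by rewrite addrA [f + h + _]addrAC.
Qed.

Lemma parrow_tgt_class t : parrow_tgt (class t) = whisker_tgt t.
Proof.
apply: (repr_class (k := whisker_tgt)) => {t} _ _ [f al g h] /=.
by rewrite addrA [f + h + _]addrAC.
Qed.

Lemma parrow_add_class c t : parrow_add c (class t) = class (whisker_add c t).
Proof.
apply: (repr_class (k := fun t => class (whisker_add c t))) => {t} _ _ [f al g h].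
by rewrite /= addrA; apply: class_deform.
Qed.

Definition poly_graph : graph := @Graph arrow2 parrow parrow_src parrow_tgt.

Definition poly_exchange : path_rel poly_graph := fun x y p q =>
  exists A B : parrow,
    arrows_of p = [:: parrow_add (parrow_src B) A; parrow_add (parrow_tgt A) B] /\
    arrows_of q = [:: parrow_add (parrow_src A) B; parrow_add (parrow_tgt B) A].

Lemma parrow_src_add c A : parrow_src (parrow_add c A) = c + parrow_src A.
Proof.
rewrite {1}/parrow_add parrow_src_class /parrow_src.
by case: (repr A) => [[f al] g] /=; rewrite !addrA.
Qed.

Lemma parrow_tgt_add c A : parrow_tgt (parrow_add c A) = c + parrow_tgt A.
Proof.
rewrite {1}/parrow_add parrow_tgt_class /parrow_tgt.
by case: (repr A) => [[f al] g] /=; rewrite !addrA.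
Qed.

Lemma poly_exchange_path (A B : parrow) :
  let x := parrow_src A + parrow_src B in
  let y := parrow_tgt A + parrow_tgt B in
  @is_path poly_graph x
    [:: parrow_add (parrow_src B) A; parrow_add (parrow_tgt A) B] y /\
  @is_path poly_graph x
    [:: parrow_add (parrow_src A) B; parrow_add (parrow_tgt B) A] y.
Proof.
by split; do !split; rewrite /= ?parrow_src_add ?parrow_tgt_add // addrC.
Qed.

Definition poly_cong : path_rel poly_graph := generated_cong poly_exchange.

End PolyGraph.

Definition Sigma3 (P : cwrs) : polygraph3 :=
  @Polygraph3 (letter P) (rule P) (@rule_src P) (@rule_tgt P).

Definition Ncwrs (S : polygraph3) : cwrs :=
  @Cwrs (cell2 S) (cell3 S) (@src2 S) (@tgt2 S).

(* Main.v *)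
From mathcomp Require Import all_boot all_algebra.
From mathcomp Require Import boolp.
Require Import Defs.

(** Modulo the deformation equations, the whiskered cell (f, al, g) is determined
    by the pair (f + g, al), and (f + g, al, 0) is a canonical representative.
    Hence (f, al, g) |-> (f + g, al) is an isomorphism of graphs over the identity
    of vertices.  It sends the exchange square of (f, al, g) and (f', be, g') to
    that of al, be and c = f + g + f' + g', and every square of the rewriting
    system arises so.  The generated congruences then correspond as well, since a
    congruence can be transported along an isomorphism in both directions. *)

Set Implicit Arguments.
Unset Strict Implicit.
Unset Printing Implicit Defensive.

Import GRing.Theory.
Local Open Scope ring_scope.

Section TransportOfCongruences.
Variables (G H : graph) (phi : graph_iso G H).

(** Proof irrelevance: the second component of a path is a proof of a [Prop]. *)
Lemma gpath_inj (K : graph) (x y : vertex K) (p q : gpath x y) :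
  arrows_of p = arrows_of q -> p = q.
Proof. by case: p q => [s hs] [t ht] /= e; apply: eq_exist. Qed.

Lemma iso_path_surj x y (q : gpath (iso_vertex phi x) (iso_vertex phi y)) :
  exists p : gpath x y, iso_path phi p = q.
Proof. by have [g _ gK] := iso_path_bij phi x y; exists (g q). Qed.

Lemma iso_vertex_surj v : exists x, iso_vertex phi x = v.
Proof. by have [g _ gK] := iso_vertex_bij phi; exists (g v). Qed.

Lemma iso_path_cat x y z (p : gpath x y) (q : gpath y z) :
  iso_path phi (pcat p q) = pcat (iso_path phi p) (iso_path phi q).
Proof. by apply: gpath_inj; rewrite /= map_cat. Qed.

Definition pullback_rel (F : path_rel H) : path_rel G :=
  fun x y p q => F _ _ (iso_path phi p) (iso_path phi q).

Lemma pullback_congruence F : is_congruence F -> is_congruence (pullback_rel F).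
Proof.
case=> eF cF; split=> [x y|x y z p p' q q' hp hq].
  have [r t s] := eF (iso_vertex phi x) (iso_vertex phi y).
  by split=> [p|p q u|p q]; [exact: r|exact: t|exact: s].
by rewrite /pullback_rel !iso_path_cat; apply: cF.
Qed.

(* Preimages are compared through their lists of arrows: equations between the
   paths themselves would need a transport along x = phi x', y = phi y'. *)
Definition pushforward_rel (E : path_rel G) : path_rel H := fun x y p q =>
  forall x' y' (p' q' : gpath x' y'),
    iso_vertex phi x' = x -> iso_vertex phi y' = y ->
    arrows_of (iso_path phi p') = arrows_of p ->
    arrows_of (iso_path phi q') = arrows_of q -> E _ _ p' q'.

(** As [phi] is injective on vertices and arrows, [p] and [q] are the only preimages of their
    images, so the quantification collapses to a single instance. *)
Lemma pushforward_relE E x y (p q : gpath x y) :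
  pushforward_rel E (iso_path phi p) (iso_path phi q) <-> E _ _ p q.
Proof.
split=> [|h x' y' p' q' ex ey]; first exact.
have vI := bij_inj (iso_vertex_bij phi); have aI := bij_inj (iso_arrow_bij phi).
move: (vI _ _ ex) (vI _ _ ey) => ? ?; subst x' y'.
by move=> /(inj_map aI)/gpath_inj -> /(inj_map aI)/gpath_inj ->.
Qed.

Lemma pushforward_congruence E :
  is_congruence E -> is_congruence (pushforward_rel E).
Proof.
case=> eE cE; split=> [u v|u v w p p' q q'].
  have [x <-] := iso_vertex_surj u; have [y <-] := iso_vertex_surj v.
  have [r t s] := eE x y.
  split=> [p|p q o|p q].
  - by have [{}p <-] := iso_path_surj p; apply/pushforward_relE/r.
  - have [{}p <-] := iso_path_surj p; have [{}q <-] := iso_path_surj q.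
    have [{}o <-] := iso_path_surj o.
    by move=> /pushforward_relE h1 /pushforward_relE h2; apply/pushforward_relE/(t _ q).
  - have [{}p <-] := iso_path_surj p; have [{}q <-] := iso_path_surj q.
    by move=> /pushforward_relE h; apply/pushforward_relE/s.
(* The types of the paths mention [u], [v], [w], so the endpoints must become images under [phi]
   before the paths can. *)
move: p p' q q'.
have [x <-] := iso_vertex_surj u; have [y <-] := iso_vertex_surj v.
have [z <-] := iso_vertex_surj w => p p' q q'.
have [{}p <-] := iso_path_surj p; have [{}q <-] := iso_path_surj q.
have [{}p' <-] := iso_path_surj p'; have [{}q' <-] := iso_path_surj q'.
move=> /pushforward_relE hp /pushforward_relE hq.
by rewrite -!iso_path_cat; apply/pushforward_relE/cE.
Qed.

(** A generated congruence is an intersection, so each inclusion needs one well-chosen member: the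
    pullback of [F] forwards, the pushforward of [E] backwards. *)
Lemma identifies_generated_cong (S : path_rel G) (T : path_rel H) :
  identifies phi S T -> identifies phi (generated_cong S) (generated_cong T).
Proof.
move=> ST x y p q; split=> h.
  move=> F cF TF; apply: (h (pullback_rel F)); first exact: pullback_congruence.
  by move=> x' y' p' q' /ST; apply: TF.
move=> E cE SE; apply/pushforward_relE; apply: h; first exact: pushforward_congruence.
move=> u v; have [x' <-] := iso_vertex_surj u; have [y' <-] := iso_vertex_surj v.
move=> p' q'; have [{}p' <-] := iso_path_surj p'; have [{}q' <-] := iso_path_surj q'.
by move=> /ST/SE h; apply/pushforward_relE.
Qed.

End TransportOfCongruences.

Section ReductionGraphs.
Variable S : polygraph3.

Definition whisker_flat (t : whisker S) : arrow2 S * cell3 S :=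
  let: (f, al, g) := t in (f + g, al).

Definition parrow_flat (A : parrow S) : arrow (cwrs_graph (Ncwrs S)) :=
  whisker_flat (repr A).

Definition parrow_of (a : arrow (cwrs_graph (Ncwrs S))) : parrow S :=
  class ((a.1, a.2, 0) : whisker S).

Lemma parrow_flat_class t : parrow_flat (class t) = whisker_flat t.
Proof.
by apply: (repr_class (k := whisker_flat)) => {t} _ _ [f al g h] /=; rewrite addrA.
Qed.

Lemma parrow_ofK : cancel parrow_of parrow_flat.
Proof. by case=> c al; rewrite /parrow_of parrow_flat_class /= addr0. Qed.

Lemma parrow_flatK : cancel parrow_flat parrow_of.
Proof.
move=> A; rewrite -[RHS]reprK /parrow_flat.
case: (repr A) => [[f al] g]; rewrite /parrow_of /=.
(* This deformation carries all of [g] across the cell, relating [(f + g, al, 0)] to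
   [(f, al, g + 0)]. *)
by rewrite (class_deform (Deform f al 0 g)) addr0.
Qed.

Lemma src_parrow_flat A : src (parrow_flat A) = parrow_src A.
Proof.
by rewrite /parrow_flat /parrow_src; case: (repr A) => [[f al] g] /=; rewrite addrAC.
Qed.

Lemma tgt_parrow_flat A : tgt (parrow_flat A) = parrow_tgt A.
Proof.
by rewrite /parrow_flat /parrow_tgt; case: (repr A) => [[f al] g] /=; rewrite addrAC.
Qed.

Lemma parrow_flat_add c A :
  parrow_flat (parrow_add c A) = (c + (parrow_flat A).1, (parrow_flat A).2).
Proof.
rewrite /parrow_add parrow_flat_class /parrow_flat.
by case: (repr A) => [[f al] g] /=; rewrite addrA.
Qed.

Definition reduction_iso : graph_iso (poly_graph S) (cwrs_graph (Ncwrs S)) :=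
  @GraphIso (poly_graph S) (cwrs_graph (Ncwrs S)) id parrow_flat
    src_parrow_flat tgt_parrow_flat (Bijective (frefl id) (frefl id))
    (Bijective parrow_flatK parrow_ofK).

Lemma reduction_iso_exchange :
  identifies reduction_iso (@poly_exchange S) (@cwrs_exchange (Ncwrs S)).
Proof.
move=> x y p q; split.
  case=> A [B [ep eq]].
  exists (parrow_flat A).2, (parrow_flat B).2, ((parrow_flat A).1 + (parrow_flat B).1).
  rewrite /arrows_of /= in ep eq *.
  rewrite ep eq /= !parrow_flat_add -!src_parrow_flat -!tgt_parrow_flat /=.
  set a := (parrow_flat A).1; set b := (parrow_flat B).1.
  split; congr [:: (_, _); (_, _)].
  - by rewrite addrC addrA.
  - by rewrite addrAC.
  - by rewrite addrAC.
  - by rewrite addrC addrA.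
case=> al [be [c [ep eq]]].
have unmap s t : map parrow_flat s = t -> s = map parrow_of t.
  by move=> <-; rewrite mapK //; exact: parrow_flatK.
(* Only the sum of the two contexts matters, so [c] may go entirely to the first arrow. *)
exists (parrow_of (c, al)), (parrow_of (0, be)).
rewrite /arrows_of (unmap _ _ ep) (unmap _ _ eq) /= /parrow_of.
rewrite !parrow_src_class !parrow_tgt_class !parrow_add_class /=.
by rewrite !(addr0, add0r) [rule_src be + c]addrC [rule_tgt be + c]addrC.
Qed.

Lemma reduction_iso_cong :
  identifies reduction_iso (@poly_cong S) (@cwrs_cong (Ncwrs S)).
Proof. exact/identifies_generated_cong/reduction_iso_exchange. Qed.

End ReductionGraphs.

Theorem theorem4p14 :
  (forall P : cwrs,
     Ncwrs (Sigma3 P) = P /\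
     exists phi : graph_iso (poly_graph (Sigma3 P)) (cwrs_graph P),
       identifies phi (@poly_cong (Sigma3 P)) (@cwrs_cong P)) /\
  (forall S : polygraph3,
     Sigma3 (Ncwrs S) = S /\
     exists phi : graph_iso (poly_graph S) (cwrs_graph (Ncwrs S)),
       identifies phi (@poly_cong S) (@cwrs_cong (Ncwrs S))).
Proof.
(* On explicit records both round trips hold by computation, so [reduction_iso] has the required
   type without transport. *)
split=> [[X R s t]|[X R s t]]; split=> //.
  by exists (reduction_iso (Sigma3 (Cwrs s t))); exact: reduction_iso_cong.
by exists (reduction_iso (Polygraph3 s t)); exact: reduction_iso_cong.
Qed.
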